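(* Let $F$ be a field, let $D$ be a central division algebra of degree $d=2$ over $F$ (a quaternion algebra), let $n$ be a positive integer, and let $\phi(z)=z^n+c_{n-1}z^{n-1}+\dots+c_0$ be a standard polynomial with $c_0,\dots,c_{n-1}\in D$. Let $\Phi(z)\in F[z]$ be the companion polynomial of $\phi(z)$, fix a root $\lambda\in D$ of $\Phi(z)$, and let $\Psi(z)=\psi_1(\lambda)z+\psi_0(\lambda)$ be the polynomial over $D$ associated to $\phi$ and $\lambda$. If $\Psi(z)$ is constantly zero (i.e. $\psi_1(\lambda)=\psi_0(\lambda)=0$), then every element in the conjugacy class of $\lambda$ in $D$ is a root of $\phi(z)$. If $\Psi(z)$ is a linear polynomial (i.e. $\psi_1(\lambda)\neq 0$), then there is exactly one root of $\phi(z)$ in the conjugacy class of $\lambda$, and it is the solution $z\in D$ of the linear equation $\Psi(z)=0$.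
   Context: A central division algebra $D$ over $F$ is a division algebra with center $F$ and of finite dimension over $F$; its degree is $d=\sqrt{[D:F]}$. A standard polynomial over $D$ is a monic polynomial whose coefficients appear on the left of the variable; a root is an element $\mu\in D$ with $\phi(\mu)=\mu^n+c_{n-1}\mu^{n-1}+\dots+c_0=0$. Two elements $d_1,d_2\in D$ are conjugate if $d_1=qd_2q^{-1}$ for some nonzero $q\in D$. Characteristic polynomials: let $m$ be a positive integer and $K$ a maximal subfield of $D$. The space of column vectors $D^m$ is a right $K$-vector space of dimension $md$; fix a $K$-linear isomorphism $g:D^m\to K^{md}$. For $A\in M_m(D)$, left multiplication by $A$ is right $K$-linear on $D^m$, so there is a unique $f(A)\in M_{md}(K)$ with $g(Av)=f(A)g(v)$ for all $v\in D^m$. The characteristic polynomial of $A$ is $\det(f(A)-zI)$. It is a known fact that its coefficients lie in $F$ and that it is independent of the choices of $K$ and $g$. The companion matrix of $\phi$ is $$C_\phi=\begin{pmatrix}0&1&0&\dots&0\\0&0&1&&0\\ \vdots&&&\ddots&\\0&0&\dots&0&1\\-c_0&-c_1&\dots&-c_{n-2}&-c_{n-1}\end{pmatrix}\in M_n(D),$$ and the companion polynomial $\Phi(z)$ is the characteristic polynomial of $C_\phi$; it has degree $nd=2n$ and coefficients in $F$. The functions $\psi_i$: for $\mu\in D$, let $z^2+C_1(\mu)z+C_0(\mu)\in F[z]$ be the (monic) characteristic polynomial of $\mu$ (the case $m=1$), so $\mu^2+C_1(\mu)\mu+C_0(\mu)=0$; it depends only on the conjugacy class of $\mu$. Using the relation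 $\mu^2=-C_1(\mu)\mu-C_0(\mu)$ repeatedly to reduce all powers of $\mu$ in $\phi(\mu)$ to powers of exponent at most $1$, one writes $\phi(\mu)=\psi_1(\mu)\mu+\psi_0(\mu)$, where $\psi_1(\mu),\psi_0(\mu)\in D$ are expressions in the $c_i$ and $C_0(\mu),C_1(\mu)$. Equivalently, $\psi_1(\mu)z+\psi_0(\mu)$ is the remainder of $\phi(z)$ on division by the central polynomial $z^2+C_1(\mu)z+C_0(\mu)$ in $D[z]$ ($z$ a central indeterminate). For example, for $\phi(z)=z^3$ one has $\psi_1=C_1^2-C_0$ and $\psi_0=C_1C_0$. *)

(* Defs.v *)
From HB Require Import structures.
From mathcomp Require Import all_boot all_order all_algebra all_field.

Set Implicit Arguments.
Unset Strict Implicit.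
Unset Printing Implicit Defensive.

Import GRing.Theory.
Local Open Scope ring_scope.

Section Definitions.

Variables (F : fieldType) (D : falgType F).

(* [falgType F] already gives finite dimension over F, and 1%VS is F itself. *)
Definition central_division_algebra (d : nat) : Prop :=
  [/\ forall x : D, x != 0 -> x \is a GRing.unit,
      'Z({:D})%VS = 1%VS
    & \dim {:D} = (d ^ 2)%N].

Definition conjugate (x y : D) : Prop :=
  exists2 q : D, q != 0 & x = q * y * q^-1.

(* In a division algebra of finite dimension, the commutative subalgebras are  *)
(* the subfields containing F; a maximal subfield always contains F.           *)
Definition maximal_subfield (K : {aspace D}) : Prop :=
  {in K &, commutative *%R} /\
  forall L : {aspace D},
    {in L &, commutative *%R} -> (K <= L)%VS -> (L <= K)%VS.

(* [v *m x%:M], with x%:M a 1 x 1 matrix, multiplies each entry of the column  *)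
(* v by x on the right.                                                        *)
Definition right_linear (K : {aspace D}) (m k : nat)
    (g : 'cV[D]_m -> 'cV[subvs_of K]_k) : Prop :=
  (forall v w, g (v + w) = g v + g w) /\
  (forall v (x : subvs_of K), g (v *m (vsval x)%:M) = g v *m x%:M).

(* p : F[z] is the characteristic polynomial det(f(A) - zI) of A, computed     *)
(* with some maximal subfield K and some right K-linear isomorphism g from D^m *)
(* to K^(md). The determinant is taken in (subvs_of K)[z], a ring which is     *)
(* commutative although its type does not record it.                           *)
Definition is_char_poly (d m : nat) (A : 'M[D]_m) (p : {poly F}) : Prop :=
  exists (K : {aspace D}) (g : 'cV[D]_m -> 'cV[subvs_of K]_(m * d))
         (fA : 'M[subvs_of K]_(m * d)),
    [/\ maximal_subfield K,
        right_linear g,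
        bijective g,
        forall v, g (A *m v) = fA *m g v
      & \det (map_mx polyC fA - 'X%:M) = map_poly (in_alg (subvs_of K)) p].

(* Evaluation [p.[x]] in {poly D} keeps the coefficients on the left of x.     *)
Definition standard_poly (n : nat) (c : 'I_n -> D) : {poly D} :=
  'X^n + \sum_(i < n) c i *: 'X^i.

Definition companion_matrix (n : nat) (c : 'I_n -> D) : 'M[D]_n :=
  \matrix_(i < n, j < n) if i.+1 == n then - c j else (i.+1 == j)%:R.

(* The pair (a, b) with z^k = a z + b modulo z^2 + C1 z + C0.                  *)
Fixpoint reduced_power (C1 C0 : F) (k : nat) : F * F :=
  if k is k'.+1 then
    let: (a, b) := reduced_power C1 C0 k' in (b - C1 * a, - (C0 * a))
  else (0, 1).

(* chi stands for the characteristic polynomial z^2 + C_1 z + C_0.             *)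
Definition psi1 (phi : {poly D}) (chi : {poly F}) : D :=
  \sum_(i < size phi) (reduced_power chi`_1 chi`_0 i).1 *: phi`_i.

Definition psi0 (phi : {poly D}) (chi : {poly F}) : D :=
  \sum_(i < size phi) (reduced_power chi`_1 chi`_0 i).2 *: phi`_i.

Definition Psi (phi : {poly D}) (chi : {poly F}) : {poly D} :=
  psi1 phi chi *: 'X + (psi0 phi chi)%:P.

End Definitions.

(* Main.v *)
(* The last row of the companion matrix C makes u_k = (C^k w)_0 a solution of   *)
(* the recurrence with coefficients phi, for every column w. If chi(C) w = 0,   *)
(* then u also satisfies the recurrence of chi, and reducing the first          *)
(* recurrence by the second one gives psi1 u_(k+1) + psi0 u_k = 0. Hence, when  *)
(* psi1 != 0 and w != 0, u is geometric of ratio z0 = - psi1^-1 psi0, and z0 is *)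
(* a root of chi. Such a w exists because the minimal polynomial m of lambda    *)
(* divides Phi, which makes m(C) singular. If lambda is not central, m = chi    *)
(* and z0 is conjugate to lambda; otherwise m(C) w = 0 says that u has ratio    *)
(* lambda, so that z0 = lambda.                                                 *)

Require Import Defs.
From HB Require Import structures.
From mathcomp Require Import all_boot all_order all_algebra all_field.
From mathcomp Require Import ring.

Set Implicit Arguments.
Unset Strict Implicit.
Unset Printing Implicit Defensive.

Import GRing.Theory.
Local Open Scope ring_scope.

(** Every conjugate mu of lambda is a root of chi ([conjugate_quadratic]), so phi(mu) = psi1 mu +
    psi0 ([horner_psi]): on the class of lambda, phi and Psi have the same roots. This settles the
    case Psi = 0; when psi1 != 0 it remains to show that the unique root z0 of Psi is conjugate to
    lambda. [is_char_polyP] supplies the column w killed by m(C), [companion_recurrence] and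
    [companion_eval] the two recurrences, [psi_recurrence] the reduction of one by the other, and
    [quadratic_conjugate] the conjugacy of z0 and lambda when lambda is not central. *)

(** * Polynomials in a matrix over a commutative ring *)

(* The characteristic polynomial d of N = m(M) satisfies                        *)
(* d(m(z)) = det (m(M) - m(z)), a multiple of det (M - z), hence of m; so m     *)
(* divides the constant d(0) = det N.                                           *)
Lemma det_horner_mx_eq0 (R : idomainType) (n : nat) (M : 'M[R]_n.+1) (m q : {poly R}) :
  (1 < size m)%N -> \det (map_mx polyC M - 'X%:M) = q * m ->
  \det (horner_mx M m) = 0.
Proof.
move=> sz_m detM; set N := horner_mx M m; set P := map_mx polyC M.
(* With a second variable Y, m(Y) - m(z) is divisible by Y - z; here Y is the outer variable and z
   the inner one. *)
have [s Ds] : exists s, map_poly polyC m - m%:P = s * ('X - 'X%:P).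
  apply/factor_theorem; rewrite rootE hornerD hornerN hornerC subr_eq0.
  by apply/eqP; rewrite -[RHS]comp_polyXr.
have mN : map_mx polyC N - m%:M = horner_mx P s *m (P - 'X%:M).
  move/(congr1 (horner_mx P)): Ds.
  by rewrite !(rmorphB, rmorphM) /= -map_horner_mx !horner_mx_C horner_mx_X.
pose d := \det (map_mx polyC N - 'X%:M).
have d0 : d.[0] = \det N.
  rewrite -[d.[0]]/(horner_eval 0 d) -det_map_mx; congr (\det _).
  apply/matrixP => i j; rewrite !mxE [LHS]hornerD hornerN hornerMn.
  by rewrite hornerC hornerX mul0rn subr0.
have dm : d \Po m = \det (map_mx polyC N - m%:M).
  rewrite -[LHS]/(comp_poly m d) -det_map_mx; congr (\det _).
  by apply/matrixP => i j; rewrite !mxE rmorphB rmorphMn /= comp_polyC comp_polyX.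
have [t Dt] : exists t, d - d.[0]%:P = t * ('X - 0%:P).
  by apply/factor_theorem; rewrite rootE hornerD hornerN hornerC subrr.
have : (\det N)%:P = (\det (horner_mx P s) * q - (t \Po m)) * m.
  rewrite mulrBl -mulrA -detM -det_mulmx -mN -dm -d0.
  move/(congr1 (comp_poly m)): Dt; rewrite rmorphB rmorphM /= comp_polyC subr0 comp_polyX.
  by move<-; rewrite opprB addrC subrK.
set r := (_ - _) => Dr.
have [r0|rn0] := eqVneq r 0.
  by apply/eqP; rewrite -polyC_eq0 Dr r0 mul0r.
have m0 : m != 0 by rewrite -size_poly_gt0 ltnW.
have r_gt0 : (0 < size r)%N by rewrite size_poly_gt0.
have := size_polyC_leq1 (\det N); rewrite Dr size_mul // leqNgt => /negP[].
by rewrite -(prednK r_gt0) addSn /= (leq_trans sz_m) ?leq_addl.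
Qed.

Lemma horner_mx_sum (R : comNzRingType) (n : nat) (M : 'M[R]_n.+1) (p : {poly R})
  (v : 'cV[R]_n.+1) :
  horner_mx M p *m v = \sum_(i < size p) iter i (mulmx M) v *m (p`_i)%:M.
Proof.
rewrite -[p in LHS]coefK poly_def rmorph_sum mulmx_suml; apply: eq_bigr => i _.
rewrite /= linearZ /= -scalemxAl rmorphXn /= horner_mx_X -mul_mx_scalar; congr (_ *m _).
elim: (val i) => [|k IH]; first by rewrite expr0 mul1mx.
by rewrite exprS -mulmxE -mulmxA IH.
Qed.

(** * Characteristic polynomials over a field extension of F *)

Section CharPolyEval.

Variables (F : fieldType) (L : fieldExtType F) (n : nat) (M : 'M[L]_n.+1).
Variable p : {poly F}.
Hypothesis det_p : \det (map_mx polyC M - 'X%:M) = map_poly (in_alg L) p.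

Lemma ext_char_poly_singular (m : {poly F}) : (1 < size m)%N -> m %| p ->
  exists2 v : 'cV[L]_n.+1, v != 0 &
    \sum_(i < size m) iter i (mulmx M) v *m (m`_i)%:A%:M = 0.
Proof.
move=> sz_m /dvdpP[q Dp].
have /eqP : \det (horner_mx M (map_poly (in_alg L) m)) = 0.
  apply: (det_horner_mx_eq0 (q := map_poly (in_alg L) q)).
    by rewrite size_map_poly.
  by rewrite det_p Dp rmorphM.
(* [det0P] yields a row vector in the left kernel, hence the transposition. *)
rewrite -det_tr => /det0P[v v0 vM]; exists v^T; first by rewrite trmx_eq0.
move/(congr1 trmx): vM; rewrite trmx_mul trmxK trmx0 horner_mx_sum size_map_poly => vM.
by rewrite -[RHS]vM; apply: eq_bigr => i _; rewrite coef_map.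
Qed.

(** The sign passes from det(M - zI) to the convention det(zI - M) of [char_poly]. *)
Lemma ext_char_polyE :
  map_poly (in_alg L) p = (-1) ^+ n.+1 *: char_poly M.
Proof.
rewrite -det_p -opprB -scaleN1r detZ -polyCN -polyC_exp mul_polyC.
by rewrite -[\det _]/(char_poly M).
Qed.

Lemma ext_size_char_poly : size p = n.+2.
Proof.
rewrite -(size_map_poly (in_alg L)) ext_char_polyE size_scale ?size_char_poly //.
by rewrite expf_neq0 // oppr_eq0 oner_eq0.
Qed.

Lemma ext_lead_coef_char_poly : lead_coef p = (-1) ^+ n.+1.
Proof.
apply: (fmorph_inj (in_alg L)); rewrite -lead_coef_map ext_char_polyE.
rewrite lead_coefZ (monicP (char_poly_monic M)) mulr1.
by rewrite rmorphXn rmorphN rmorph1.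
Qed.

Lemma ext_Cayley_Hamilton (v : 'cV[L]_n.+1) :
  \sum_(i < size p) iter i (mulmx M) v *m (p`_i)%:A%:M = 0.
Proof.
have : horner_mx M (map_poly (in_alg L) p) = 0.
  by rewrite ext_char_polyE linearZ /= Cayley_Hamilton scaler0.
move/(congr1 (mulmx^~ v)); rewrite mul0mx horner_mx_sum size_map_poly => vM.
by rewrite -[RHS]vM; apply: eq_bigr => i _; rewrite coef_map.
Qed.

End CharPolyEval.

(** * Transfer to matrices over the division algebra *)

Section CharPolyMatrix.

Variables (F : fieldType) (D : falgType F).
Hypothesis unitD : forall x : D, x != 0 -> x \is a GRing.unit.

(** The column q(A) w, with the coefficients acting on the right, where [right_linear] maps can
    carry them across. *)
Definition matrix_eval (m : nat) (A : 'M[D]_m) (q : {poly F}) (w : 'cV[D]_m) : 'cV[D]_m :=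
  \sum_(i < size q) iter i (mulmx A) w *m (q`_i)%:A%:M.

(** The isomorphism g carries q(A) w to q(fA) (g w), so Cayley-Hamilton and the singularity of q(fA)
    over the field K pull back to D. The choice of K and g does not appear in the conclusion. *)
Lemma is_char_polyP (d m k : nat) (A : 'M[D]_m) (p : {poly F}) :
    (m * d)%N = k.+1 -> is_char_poly d A p ->
  [/\ size p = k.+2, lead_coef p = (-1) ^+ k.+1,
      forall w, matrix_eval A p w = 0
    & forall q : {poly F}, (1 < size q)%N -> q %| p ->
        exists2 w, w != 0 & matrix_eval A q w = 0].
Proof.
move=> Dk; rewrite /is_char_poly Dk => -[K [g [fA [[mulK _] [gD gZ] g_bij gA detA]]]].
have mulC : commutative (fun x y : subvs_of K => x * y).
  by move=> x y; apply/val_inj/mulK; apply: subvsP.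
have unitK (x : subvs_of K) : x != 0 -> x \is a GRing.unit.
  move=> x0; apply/vsval_unitr/unitD; apply: contraNneq x0 => x0.
  by apply/eqP/val_inj.
(* The unit of [subvs_of K] is the identity element of K, which in a division algebra is 1. *)
have vsvalA (a : F) : vsval (a%:A : subvs_of K) = a%:A.
  by rewrite /= (skew_field_algid1 unitD).
have g0 : g 0 = 0 by apply: (@addrI _ (g 0)); rewrite -gD !addr0.
have gE q w : g (matrix_eval A q w) =
    \sum_(i < size q) iter i (mulmx fA) (g w) *m (q`_i)%:A%:M.
  rewrite /matrix_eval; elim/big_ind2: _ => // [x1 x2 y1 y2 <- <- // | i _].
  rewrite -vsvalA gZ; congr (_ *m _).
  by elim: (val i) => //= j <-; rewrite gA.
have [g' gK g'K] := g_bij.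
(* The type [subvs_of K] does not record that K is commutative. *)
pose comK := GRing.PzRing_hasCommutativeMul.Build (subvs_of K) mulC.
pose comUnitK : comUnitRingType := HB.pack (subvs_of K) comK.
pose fieldK := GRing.ComUnitRing_isField.Build comUnitK unitK.
pose L : fieldExtType F := HB.pack (subvs_of K) comK fieldK.
split.
- exact: (@ext_size_char_poly F L k fA p).
- exact: (@ext_lead_coef_char_poly F L k fA p).
- move=> w; apply: (bij_inj g_bij); rewrite gE g0.
  exact: (@ext_Cayley_Hamilton F L k fA p detA).
- move=> q sz_q q_p.
  have [v v0 vq] := @ext_char_poly_singular F L k fA p detA q sz_q q_p.
  exists (g' v); first by apply: contraNneq v0 => v0; rewrite -(g'K v) v0 g0.
  by apply: (bij_inj g_bij); rewrite gE g0 g'K.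
Qed.

End CharPolyMatrix.

(** * Reduction modulo a quadratic polynomial *)

Section Recurrence.

Variables (F : fieldType) (D : falgType F).

Lemma reduced_powerP (C1 C0 : F) (u : nat -> D) :
    (forall k, u k.+2 + C1 *: u k.+1 + C0 *: u k = 0) ->
  forall k, u k = (reduced_power C1 C0 k).1 *: u 1%N + (reduced_power C1 C0 k).2 *: u 0%N.
Proof.
move=> u_rec; elim/ltn_ind=> -[_|[_|k IH]].
- by rewrite /= scale0r scale1r add0r.
- by rewrite /= !mulr0 subr0 oppr0 scale0r scale1r addr0.
have -> : u k.+2 = - (C1 *: u k.+1 + C0 *: u k).
  by apply/eqP; rewrite -addr_eq0 addrA u_rec.
rewrite (IH k.+1) // (IH k) //=; case: (reduced_power C1 C0 k) => a b /=.
rewrite !scalerDr !scalerA !opprD -!scaleNr addrACA -!scalerDl.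
by congr (_ *: _ + _ *: _); ring.
Qed.

(** Stated for sequences so as to cover both the powers of a root of chi and the shifts of a
    companion sequence. *)
Lemma psi_recurrence (phi : {poly D}) (chi : {poly F}) (u : nat -> D) :
    (forall k, u k.+2 + chi`_1 *: u k.+1 + chi`_0 *: u k = 0) ->
  \sum_(i < size phi) phi`_i * u i = psi1 phi chi * u 1%N + psi0 phi chi * u 0%N.
Proof.
move=> u_rec; rewrite /psi1 /psi0 !mulr_suml -big_split; apply: eq_bigr => i _ /=.
by rewrite [in LHS](reduced_powerP u_rec) mulrDr -!scalerAr -!scalerAl.
Qed.

Lemma horner_Psi (phi : {poly D}) (chi : {poly F}) (x : D) :
  (Psi phi chi).[x] = psi1 phi chi * x + psi0 phi chi.
Proof. by rewrite /Psi hornerD hornerZ hornerX hornerC. Qed.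

Lemma horner_monic_quadratic (chi : {poly F}) (x : D) : size chi = 3 -> chi \is monic ->
  (map_poly (in_alg D) chi).[x] = x * x + chi`_1 *: x + (chi`_0)%:A.
Proof.
move=> sz_chi; rewrite monicE lead_coefE sz_chi => /eqP /= chi2.
rewrite horner_coef size_map_poly sz_chi !big_ord_recl big_ord0 !coef_map /= chi2.
by rewrite expr0 mulr1 expr1 addr0 scale1r mul1r expr2 mulr_algl [RHS]addrC [X in _ + X]addrC.
Qed.

Lemma horner_psi (phi : {poly D}) (chi : {poly F}) (x : D) :
    x * x + chi`_1 *: x + (chi`_0)%:A = 0 ->
  phi.[x] = psi1 phi chi * x + psi0 phi chi.
Proof.
move=> x_chi; rewrite horner_coef (@psi_recurrence phi chi (fun k => x ^+ k)).
  by rewrite expr0 expr1 mulr1.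
move=> k; rewrite -[RHS](mul0r (x ^+ k)) -x_chi !mulrDl mulr_algl.
by rewrite -scalerAl -exprS -mulrA -exprS -exprS.
Qed.

End Recurrence.

(** * Sequences attached to a companion matrix *)

Section Companion.

Variables (F : fieldType) (D : falgType F) (n : nat) (c : 'I_n.+1 -> D).

Lemma standard_poly_coef (i : nat) : (standard_poly c)`_i =
  (i == n.+1)%:R + \sum_(j < n.+1) c j * (i == j)%:R.
Proof.
rewrite coefD coefXn coef_sum; congr (_ + _); apply: eq_bigr => j _.
by rewrite coefZ coefXn.
Qed.

Lemma standard_poly_sum (u : nat -> D) :
  \sum_(i < size (standard_poly c)) (standard_poly c)`_i * u i =
  \sum_(j < n.+1) c j * u j + u n.+1.
Proof.
have sz : (size (standard_poly c) <= n.+2)%N.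
  apply/leq_sizeP => i le_i; rewrite standard_poly_coef gtn_eqF // add0r.
  apply: big1 => j _; rewrite gtn_eqF ?mulr0 //.
  exact: leq_trans (ltn_ord j) (ltnW le_i).
have -> : \sum_(i < size (standard_poly c)) (standard_poly c)`_i * u i =
  \sum_(i < n.+2) (standard_poly c)`_i * u i.
  rewrite (big_ord_widen _ (fun i => (standard_poly c)`_i * u i) sz) big_mkcond /=.
  by apply: eq_bigr => i _; case: ltnP => // le_i; rewrite nth_default ?mul0r.
rewrite big_ord_recr /=; congr (_ + _).
  apply: eq_bigr => i _; rewrite standard_poly_coef ltn_eqF // add0r.
  rewrite (bigD1 i) //= eqxx mulr1 big1 ?addr0 // => j ji.
  by rewrite -val_eqE eq_sym /= in ji; rewrite (negPf ji) mulr0.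
rewrite standard_poly_coef eqxx big1 ?addr0 ?mul1r // => j _.
by rewrite gtn_eqF ?mulr0.
Qed.

Variable w : 'cV[D]_n.+1.
Let u (k : nat) : D := iter k (mulmx (companion_matrix c)) w 0 0.

(** All rows of C but the last shift entries upwards, so the sequence u of top entries determines
    every column C^k w. *)
Lemma companion_iter (i : 'I_n.+1) (k : nat) :
  iter k (mulmx (companion_matrix c)) w i 0 = u (k + i).
Proof.
case: i => i; elim: i k => [|i IH] k lt_i.
  by rewrite addn0 /u; congr (fun_of_matrix _ _ _); apply: val_inj.
rewrite /= addnS -addSn -(IH k.+1 (ltnW lt_i)) iterS [RHS]mxE.
rewrite (bigD1 (Ordinal lt_i)) //= !mxE /= ltn_eqF // eqxx mul1r big1 ?addr0 // => j.
by rewrite !mxE /= ltn_eqF // -val_eqE eq_sym /= => /negPf->; rewrite mul0r.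
Qed.

Lemma companion_recurrence (k : nat) :
  \sum_(j < n.+1) c j * u (k + j) + u (k + n.+1) = 0.
Proof.
rewrite addnS -addSn -[n in u (_ + n)]/(nat_of_ord (@ord_max n)) -companion_iter iterS mxE.
rewrite -big_split big1 // => j _ /=.
by rewrite !mxE eqxx mulNr -companion_iter subrr.
Qed.

(** C^k acts on the left and the coefficients on the right, so C^k q(C) w = 0 can be expanded
    termwise; its top entry is the sum. *)
Lemma companion_eval (q : {poly F}) (k : nat) :
  matrix_eval (companion_matrix c) q w = 0 -> \sum_(i < size q) q`_i *: u (k + i) = 0.
Proof.
move=> qw.
have : iter k (mulmx (companion_matrix c)) (matrix_eval (companion_matrix c) q w) 0 0 = 0.
  rewrite qw; suff -> : iter k (mulmx (companion_matrix c)) 0 = 0 :> 'cV_n.+1 by rewrite mxE.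
  by elim: k => //= k ->; rewrite mulmx0.
suff -> : iter k (mulmx (companion_matrix c)) (matrix_eval (companion_matrix c) q w) =
  \sum_(i < size q) iter (k + i) (mulmx (companion_matrix c)) w *m (q`_i)%:A%:M.
  rewrite summxE => u0; rewrite -[RHS]u0; apply: eq_bigr => i _.
  by rewrite mxE big_ord1 !mxE eqxx mulr1n mulr_algr.
elim: k => //= k ->; rewrite mulmx_sumr; apply: eq_bigr => i _.
by rewrite mulmxA.
Qed.

End Companion.

(** * Quadratic elements and their conjugates *)

Section Quadratic.

Variables (F : fieldType) (D : falgType F).
Hypothesis unitD : forall x : D, x != 0 -> x \is a GRing.unit.

(** With [xbar] = - C1 - x, so that [xbar * x] = C0, the element y t - t [xbar] intertwines y and x
    for every t. *)
Lemma quadratic_conjugate (C1 C0 : F) (x y z : D) :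
    x * x + C1 *: x + C0%:A = 0 -> y * y + C1 *: y + C0%:A = 0 -> z * x != x * z ->
  conjugate y x.
Proof.
move=> x_eq y_eq zx.
pose xbar := - (C1%:A + x).
have xbar_x : xbar * x = C0%:A.
  by rewrite mulNr mulrDl mulr_algl addrC; apply: addr0_eq.
have yy : y * y = - (C1 *: y) - C0%:A.
  by apply/eqP; rewrite -opprD -addr_eq0 addrA y_eq.
(* Each q t satisfies y q = q x; one of q 1 and q z is nonzero. *)
pose q t := y * t - t * xbar.
have qP t : y * q t = q t * x.
  rewrite mulrBr mulrBl -[t * xbar * x]mulrA xbar_x !mulrA yy.
  rewrite /xbar mulrN opprK mulrDr mulrDl !mulNr !mulr_algl !mulr_algr -scalerAl.
  by rewrite addrACA addNr add0r addrC.
have [t qt0] : exists t, q t != 0.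
  have [q1|] := eqVneq (q 1) 0; last by exists 1.
  (* If q 1 = 0 then y = [xbar], and q z = 0 would make z commute with [xbar], hence with x. *)
  exists z; apply: contra_neq zx => qz.
  move: q1 qz; rewrite /q mulr1 mul1r => /eqP; rewrite subr_eq0 => /eqP -> /eqP.
  rewrite subr_eq0 /xbar mulNr mulrN eqr_opp mulrDl mulrDr mulr_algl mulr_algr.
  by move/eqP/addrI.
exists (q t) => //; by rewrite -qP mulrK ?unitD.
Qed.

Lemma conjugate_quadratic (C1 C0 : F) (x y : D) :
    x * x + C1 *: x + C0%:A = 0 -> conjugate y x -> y * y + C1 *: y + C0%:A = 0.
Proof.
move=> x_eq [q q0 ->]; have Uq := unitD q0.
have <- : q * (x * x + C1 *: x + C0%:A) * q^-1 = 0 by rewrite x_eq mulr0 mul0r.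
rewrite !mulrDr !mulrDl mulr_algr -!scalerAl divrr // -!scalerAr -!scalerAl.
by rewrite !mulrA mulrVK.
Qed.

(** An x outside F is a root of no nonzero polynomial of degree at most 1 over F, so the remainder
    of q modulo p vanishes. *)
Lemma quadratic_dvdp (p q : {poly F}) (x : D) : size p = 3 ->
    (map_poly (in_alg D) p).[x] = 0 -> (map_poly (in_alg D) q).[x] = 0 ->
  x \notin 1%VS -> p %| q.
Proof.
move=> sz_p px qx xF; apply/modp_eq0P; pose r := q %% p.
have sz_r : (size r <= 2)%N.
  by rewrite -ltnS -[X in (_ < X)%N]sz_p ltn_modp -size_poly_gt0 sz_p.
have rx : r`_1 *: x + r`_0 *: 1 = 0.
  have : horner_alg x r = 0.
    move: qx; rewrite -[LHS]/(horner_alg x q) (divp_eq q p) rmorphD rmorphM /=.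
    by rewrite {2}/horner_alg /horner_morph px mulr0 add0r.
  rewrite /horner_alg /horner_morph (horner_coef_wide (n := 2)) ?size_map_poly //.
  rewrite !big_ord_recl big_ord0 !coef_map /= expr0 expr1 mulr1 addr0 mulr_algl.
  by rewrite addrC.
have r1 : r`_1 = 0.
  apply: contraNeq xF => r1; apply/vlineP; exists (- (r`_0 / r`_1)).
  apply: (scalerI r1); rewrite scalerA mulrN mulrC divfK // scaleNr.
  by apply/eqP; rewrite -addr_eq0 rx.
have r0 : r`_0 = 0.
  by move/eqP: rx; rewrite r1 scale0r add0r scaler_eq0 oner_eq0 orbF => /eqP.
apply/polyP => -[|[|i]]; rewrite coef0 -/r //.
by rewrite nth_default // (leq_trans sz_r).
Qed.

End Quadratic.

(** * Roots of phi in the conjugacy class of lambda *)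

Theorem corollary4p3 (F : fieldType) (D : falgType F)
    (hD : central_division_algebra D 2)
    (n : nat) (n_gt0 : (0 < n)%N) (c : 'I_n -> D)
    (Phi : {poly F}) (hPhi : is_char_poly 2 (companion_matrix c) Phi)
    (lambda : D) (hlambda : root (map_poly (in_alg D) Phi) lambda)
    (chi : {poly F}) (hchi : is_char_poly 2 (lambda%:M : 'M[D]_1) chi) :
  (Psi (standard_poly c) chi = 0 ->
     forall mu : D, conjugate mu lambda -> root (standard_poly c) mu)
  /\
  (psi1 (standard_poly c) chi != 0 ->
     exists mu : D,
       [/\ conjugate mu lambda,
           root (standard_poly c) mu,
           forall nu : D, conjugate nu lambda ->
             root (standard_poly c) nu -> nu = mu
         & forall z : D, root (Psi (standard_poly c) chi) z <-> z = mu]).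
Proof.
have [unitD centerD _] := hD.
case: n n_gt0 c hPhi => // n _ c hPhi; set phi := standard_poly c.
have [sz_chi lead_chi chi_lambda _] := is_char_polyP unitD (mul1n 2) hchi.
have [_ _ _ singPhi] := is_char_polyP unitD (muln2 n.+1) hPhi.
have chi2 : chi`_2 = 1 by move: lead_chi; rewrite lead_coefE sz_chi sqrrN expr1n.
have mon_chi : chi \is monic by rewrite monicE lead_chi sqrrN expr1n.
have lambda_eq : lambda * lambda + chi`_1 *: lambda + (chi`_0)%:A = 0.
  (* Cayley-Hamilton for the 1 x 1 matrix lambda, applied to the column 1. *)
  have /matrixP/(_ 0 0) := chi_lambda 1%:M.
  rewrite /matrix_eval sz_chi !big_ord_recl big_ord0 /= chi2 addr0.
  rewrite !mulmx1 -!scalar_mxM -!raddfD !mxE eqxx !mulr1n.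
  rewrite mul1r mulr_algr scale1r mulr1 => <-.
  by rewrite [RHS]addrC; congr (_ + _); apply: addrC.
have eval_conj mu : conjugate mu lambda ->
    phi.[mu] = psi1 phi chi * mu + psi0 phi chi.
  by move=> /(conjugate_quadratic unitD lambda_eq); apply: horner_psi.
split=> [Psi0 mu mu_conj | psi1_neq0].
  by rewrite rootE eval_conj // -horner_Psi Psi0 horner0.
pose z0 := - ((psi1 phi chi)^-1 * psi0 phi chi).
have Psi_z0 z : psi1 phi chi * z + psi0 phi chi = 0 <-> z = z0.
  split=> [/eqP|->].
    rewrite addr_eq0 => /eqP psi_z; apply: (mulrI (unitD _ psi1_neq0)).
    by rewrite psi_z mulrN mulVKr ?unitD.
  by rewrite mulrN mulVKr ?unitD // addNr.
suff z0_conj : conjugate z0 lambda.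
  exists z0; split=> // [|nu nu_conj|z].
  - by rewrite rootE eval_conj //; apply/eqP/Psi_z0.
  - by rewrite rootE eval_conj // => /eqP/Psi_z0.
  - by rewrite rootE horner_Psi -Psi_z0; split=> /eqP.
(* Reducing the recurrence of phi at each shift k gives psi1 u_(k+1) + psi0 u_k = 0; a geometric
   sequence with u_0 = 0 would vanish. *)
have ratio (u : nat -> D) :
    (forall k, u k.+2 + chi`_1 *: u k.+1 + chi`_0 *: u k = 0) ->
    (forall k, \sum_(j < n.+1) c j * u (k + j)%N + u (k + n.+1)%N = 0) ->
    (exists k, u k != 0) -> u 0%N != 0 /\ forall k, u k.+1 = z0 * u k.
  move=> u_chi u_phi [l ul].
  have uS k : u k.+1 = z0 * u k.
    have : \sum_(i < size phi) phi`_i * u (k + i)%N = 0.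
      by rewrite (standard_poly_sum c (fun i => u (k + i)%N)).
    rewrite (@psi_recurrence _ _ phi chi (fun i => u (k + i)%N)) => [|i]; last first.
      by rewrite !addnS.
    rewrite addn0 addn1 => /eqP; rewrite addr_eq0 => /eqP psi_u.
    apply: (mulrI (unitD _ psi1_neq0)).
    by rewrite psi_u mulNr mulrN -!mulrA mulVKr ?unitD.
  split=> //; apply: contra_neq ul => u0.
  by elim: l => // l IH; rewrite uS IH mulr0.
pose u (w : 'cV[D]_n.+1) (k : nat) : D := iter k (mulmx (companion_matrix c)) w 0 0.
have u_neq0 w : w != 0 -> exists k, u w k != 0.
  case/matrix0Pn=> i [j]; rewrite ord1 => wi0; exists i.
  by rewrite /u -[nat_of_ord i]add0n -companion_iter.
have [lambdaF | lambdaF] := boolP (lambda \in 1%VS).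
  have [a Da] := vlineP _ _ lambdaF.
  have [|| w w0 w_eq] := singPhi ('X - a%:P).
  - by rewrite size_XsubC.
  - rewrite dvdp_XsubCl; move: hlambda; rewrite Da rootE.
    by rewrite -[a%:A]/(in_alg D a) horner_map fmorph_eq0.
  have uS k : u w k.+1 = a *: u w k.
    have := companion_eval k w_eq; rewrite size_XsubC !big_ord_recl big_ord0.
    rewrite !coefB !coefX !coefC /= subr0 sub0r scale1r addr0 addn0 addn1 => /eqP.
    by rewrite addrC scaleNr subr_eq0 => /eqP.
  (* chi(a) = 0 makes the sequence of ratio a satisfy the recurrence of chi as well, so that [ratio]
     applies. *)
  have chi_a : a * a + chi`_1 * a + chi`_0 = 0.
    move: lambda_eq; rewrite Da -scalerAl mul1r !scalerA -!scalerDl => /eqP.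
    by rewrite scaler_eq0 oner_eq0 orbF => /eqP.
  have [||| u0 uz] := ratio (u w); last 1 first.
  (* The ratios a and z0 agree after cancelling u_0, so z0 = lambda, conjugate to itself by 1. *)
  - have := uz 0%N; rewrite uS -mulr_algl -Da => /(mulIr (unitD _ u0)) <-.
    by exists 1; rewrite ?oner_eq0 // invr1 mulr1 mul1r.
  - by move=> k; rewrite !uS !scalerA -!scalerDl chi_a scale0r.
  - exact: companion_recurrence.
  - exact: u_neq0.
have chi_Phi : chi %| Phi.
  apply: (quadratic_dvdp sz_chi _ (eqP hlambda) lambdaF).
  by rewrite horner_monic_quadratic.
have [|| w w0 w_eq] := singPhi chi; rewrite ?sz_chi //.
have u_chi k : u w k.+2 + chi`_1 *: u w k.+1 + chi`_0 *: u w k = 0.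
  have := companion_eval k w_eq; rewrite sz_chi !big_ord_recl big_ord0 /=.
  rewrite chi2 scale1r addr0 addn0 addn1 addn2 => <-.
  by rewrite [RHS]addrC; congr (_ + _); apply: addrC.
have [u0 uz] := ratio (u w) u_chi (companion_recurrence _ _) (u_neq0 w w0).
(* The recurrence of chi at k = 0 reads chi(z0) u_0 = 0. *)
have z0_eq : z0 * z0 + chi`_1 *: z0 + (chi`_0)%:A = 0.
  apply: (mulIr (unitD _ u0)); rewrite mul0r -[RHS](u_chi 0%N) !uz !mulrDl mulr_algl.
  by rewrite mulrA scalerAl.
have [z zl] : exists z, z * lambda != lambda * z.
  have : ~~ ({:D} <= 'C[lambda])%VS.
    by apply: contra lambdaF; rewrite subv_cent1 -centerD memv_cap memvf.
  by case/subvPn=> z _ /cent1vP/eqP; exists z.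
exact: (quadratic_conjugate unitD lambda_eq z0_eq zl).
Qed.
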